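(* There is an absolute constant $C>0$ such that the following holds. Let $n$ be a positive integer, let $d_1,\dots,d_n\in\mathbb{C}$ and $\phi_1,\dots,\phi_n\in\mathbb{R}$, and put $A_k(x)=d_k\cos(kx+\phi_k)$ for $k=1,\dots,n$. Then for every positive integer $m\le n$ there is a set $K\subset\{1,\dots,n\}$ such that $|K|=m$ and $$\left\|\sum_{k\in K}A_k\right\|\le C\,\log\log\log(n+20)\,\left\|\sum_{k=1}^n A_k\right\|.$$
   Context: $\mathbb{T}=\mathbb{R}/2\pi\mathbb{Z}$; for a continuous function $g:\mathbb{T}\to\mathbb{C}$, $\|g\|=\max_{x\in\mathbb{T}}|g(x)|$ is the uniform norm. $\log$ is the natural logarithm. $|K|$ denotes the cardinality of a finite set $K$. *)

(* Defs.v *)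
From HB Require Import structures.
From mathcomp Require Import all_boot all_order all_algebra.
From mathcomp Require Import all_classical all_reals all_analysis.
From mathcomp Require Import complex.

Set Implicit Arguments.
Unset Strict Implicit.
Unset Printing Implicit Defensive.

Import Order.TTheory GRing.Theory Num.Theory.
Import numFieldNormedType.Exports.

Local Open Scope classical_set_scope.
Local Open Scope complex_scope.
Local Open Scope ring_scope.

(* The uniform norm of a function on the circle R / 2 pi Z, the function being
   given as a 2 pi-periodic map g on the real line.  [sup] is a maximum when g
   is continuous and periodic (unorm_ge and unorm_attained below); it would be
   the junk value 0 if |g| were unbounded. *)
Definition unorm (R : realType) (g : R -> R[i]) : R :=
  sup [set Normc.normc (g x) | x in [set: R]].

(* The index i : 'I_n stands for the frequency k = i + 1 in {1, ..., n}. *)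
Definition cosine_term (R : realType) (n : nat) (d : 'I_n -> R[i])
    (phi : 'I_n -> R) (i : 'I_n) (x : R) : R[i] :=
  d i * (cos (i.+1%:R * x + phi i))%:C.

Lemma periodicz (R : realType) (T : Type) (g : R -> T) (p : R) :
  (forall x, g (x + p) = g x) -> forall (z : int) x, g (x + z%:~R * p) = g x.
Proof.
move=> gp; have gn (k : nat) y : g (y + k%:R * p) = g y.
  elim: k y => [|k IH] y; first by rewrite mul0r addr0.
  by rewrite -natr1 mulrDl mul1r addrA gp IH.
case=> k x; first exact: gn.
by rewrite NegzE mulrNz mulNr -(gn k.+1) subrK.
Qed.

Lemma periodic_max (R : realType) (g : R -> R[i]) :
  continuous (fun x => Normc.normc (g x)) ->
  (forall x, g (x + 2 * pi) = g x) ->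
  exists c, forall x, Normc.normc (g x) <= Normc.normc (g c).
Proof.
move=> g_cont g_periodic.
have p0 : 0 < 2 * pi :> R by rewrite mulr_gt0 ?pi_gt0.
have [|c _ cmax] := EVT_max (ltW p0) (f := fun x => Normc.normc (g x)).
  exact: continuous_subspaceT.
exists c => x.
set z := Num.floor (x / (2 * pi)).
rewrite -(periodicz g_periodic (- z) x); apply: cmax.
rewrite in_itv /= mulrNz mulNr subr_ge0 lerBlDr -ler_pdivlMr// floor_le /=.
rewrite -[X in X + _]mul1r -mulrDl -ler_pdivrMr// ltW// addrC.
by rewrite -(intrD _ z 1) floorD1_gt.
Qed.

Lemma unorm_ge (R : realType) (g : R -> R[i]) :
  continuous (fun x => Normc.normc (g x)) ->
  (forall x, g (x + 2 * pi) = g x) ->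
  forall x, Normc.normc (g x) <= unorm g.
Proof.
move=> g_cont g_periodic x.
have [c cmax] := periodic_max g_cont g_periodic.
apply: ub_le_sup; last by exists x.
by exists (Normc.normc (g c)) => _ [y _ <-].
Qed.

Lemma unorm_attained (R : realType) (g : R -> R[i]) :
  continuous (fun x => Normc.normc (g x)) ->
  (forall x, g (x + 2 * pi) = g x) ->
  exists x, unorm g = Normc.normc (g x).
Proof.
move=> g_cont g_periodic.
have [c cmax] := periodic_max g_cont g_periodic; exists c.
apply/eqP; rewrite eq_le unorm_ge// andbT.
apply: ge_sup; first by exists (Normc.normc (g c)), c.
by move=> _ [y _ <-].
Qed.

(* Main.v *)
(* The multiples of q, the odd multiples of c and the residues ±g mod q are
   selected from a trigonometric sum by averaging its translates by 2 pi j / q,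
   at the cost of a bounded factor.  It remains to build a set of m indices out
   of few such classes.  Passing to the complement, let m <= n / 2.  Once a
   bounded number of odd residue classes has made the remainder r small against
   n, classes "odd multiples of 2^i a" with a odd and i = 1, 2, ... are pairwise
   disjoint, and the first a that fits replaces the relative remainder y by
   O(y^2), as in a greedy Egyptian fraction.  After O(log log log n) steps the
   remainder is below n / (log n)^2, and the last r indices can be drawn at
   random, without the few large coefficients, from the untouched multiples of a
   power of 2: the sampling rate is so small that the random fluctuation at
   O(n^2) grid points stays bounded. *)

Require Import Defs.
From HB Require Import structures.
From mathcomp Require Import all_boot all_order all_algebra.
From mathcomp Require Import all_classical all_reals all_analysis.
From mathcomp Require Import complex.
From mathcomp Require Import zify ring lra.

Set Implicit Arguments.
Unset Strict Implicit.
Unset Printing Implicit Defensive.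

Import Order.TTheory GRing.Theory Num.Theory.
Import numFieldNormedType.Exports.

Local Open Scope ring_scope.

(** * Cosine sums over arithmetic progressions and roots of unity *)

Lemma cosD2piz (R : realType) (x : R) (z : int) : cos (x + z%:~R * (2 * pi)) = cos x.
Proof. by apply: periodicz => y; rewrite mulr_natl cosD2pi. Qed.

(** The sum telescopes, since [2 sin h cos A = sin (A + h) - sin (A - h)]. *)
Lemma sum_cos_arith (R : realType) (t h : R) (q : nat) :
  2 * sin h * \sum_(j < q) cos (t + j%:R * (2 * h)) =
  sin (t + (q%:R * 2 - 1) * h) - sin (t - h).
Proof.
elim: q => [|q IH]; first by rewrite big_ord0 mulr0 mul0r sub0r mulN1r subrr.
rewrite big_ord_recr /= mulrDr IH -(natr1 q).
have -> : t + ((q%:R + 1) * 2 - 1) * h = (t + q%:R * (2 * h)) + h by ring.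
have -> : t + (q%:R * 2 - 1) * h = (t + q%:R * (2 * h)) - h by ring.
by set A := t + _ * _; rewrite (sinD A h) (sinB A h); ring.
Qed.

Lemma sin_pi_frac_neq0 (R : realType) (q d : nat) : (0 < q)%N -> ~~ (q %| d)%N ->
  sin (d%:R * pi / q%:R : R) != 0.
Proof.
move=> q0 qd.
have q0' : q%:R != 0 :> R by rewrite pnatr_eq0 -lt0n.
have -> : d%:R * pi / q%:R = (d %% q)%:R * pi / q%:R + pi *+ (d %/ q) :> R.
  rewrite {1}(divn_eq d q) natrD natrM -mulr_natl.
  by field.
rewrite (alternatingn (@sinDpi R)) mulf_neq0 ?signr_eq0 //.
rewrite gt_eqF// sin_gt0_pi//.
have r0 : (0 < d %% q)%N by rewrite lt0n.
rewrite divr_gt0 ?mulr_gt0 ?ltr0n ?pi_gt0//=.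
by rewrite ltr_pdivrMr ?ltr0n// mulrC ltr_pM2l ?pi_gt0// ltr_nat ltn_mod.
Qed.

(** Real form of the orthogonality of the [q]-th roots of unity. *)
Lemma sum_cos_roots (R : realType) (t : R) (q k l : nat) : (0 < q)%N ->
  \sum_(j < q) cos (t + (k%:R - l%:R) * (j%:R * (2 * pi / q%:R))) =
  if k == l %[mod q] then q%:R * cos t else 0.
Proof.
move=> q0; wlog lk : t k l / (l <= k)%N => [H|].
  case/orP: (leq_total l k) => lk; first exact: H.
  rewrite eq_sym -[RHS]/(if l == k %[mod q] then q%:R * cos t else 0) -(cosN t) -(H (- t) l k lk).
  by apply: eq_bigr => j _; rewrite -cosN; congr cos; ring.
have q0' : q%:R != 0 :> R by rewrite pnatr_eq0 -lt0n.
rewrite eqn_mod_dvd// -natrB//; move: (k - l)%N => d {k l lk}.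
case: ifP => qd.
  rewrite (eq_bigr (fun=> cos t)) ?sumr_const ?card_ord ?mulr_natl// => j _.
  rewrite -[RHS](cosD2piz _ (d %/ q * j)%N); congr (cos (_ + _)).
  by rewrite -pmulrn natrM -{1}(divnK qd) natrM; field.
(* After multiplication by this nonzero sine the sum telescopes; the arguments of the two end terms
   differ by [2 pi d], so they cancel. *)
apply: (mulfI (x := 2 * sin (d%:R * pi / q%:R))).
  by rewrite mulf_neq0// ?pnatr_eq0// sin_pi_frac_neq0// qd.
rewrite mulr0.
under eq_bigr => j _ do
  have -> : d%:R * (j%:R * (2 * pi / q%:R)) = j%:R * (2 * (d%:R * pi / q%:R)) :> R by ring.
rewrite sum_cos_arith.
have -> : t + (q%:R * 2 - 1) * (d%:R * pi / q%:R) =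
          (t - d%:R * pi / q%:R) + (pi *+ 2) *+ d.
  by rewrite -[_ *+ d]mulr_natl -[pi *+ 2]mulr_natl; field.
by rewrite (periodicn (@sinD2pi R)) subrr.
Qed.

(** * Selecting frequencies from a trigonometric sum *)

Definition subsum (R : realType) (n : nat) (a phi : 'I_n -> R) (A : {set 'I_n})
    (x : R) : R :=
  \sum_(k in A) a k * cos (k.+1%:R * x + phi k).

(** A bound for the operator that keeps the frequencies in [A]. It is uniform in the coefficients,
    so that one set serves real and imaginary parts at once. *)
Definition filter_bound (R : realType) (n : nat) (phi : 'I_n -> R)
    (A : {set 'I_n}) (c : R) : Prop :=
  forall a : 'I_n -> R, (forall x, `|subsum a phi [set: 'I_n] x| <= 1) ->
  forall x, `|subsum a phi A x| <= c.

Lemma subsumU (R : realType) (n : nat) (a phi : 'I_n -> R) (A B : {set 'I_n}) x :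
  [disjoint A & B] ->
  subsum a phi (A :|: B) x = subsum a phi A x + subsum a phi B x.
Proof.
move=> dAB; rewrite /subsum -bigU//; apply: eq_bigl => k; by rewrite inE. 
Qed.

Lemma filter_bound0 (R : realType) (n : nat) (phi : 'I_n -> R) :
  filter_bound phi finset.set0 0.
Proof. by move=> a _ x; rewrite /subsum big_set0 normr0. Qed.

Lemma filter_boundU (R : realType) (n : nat) (phi : 'I_n -> R)
    (A B : {set 'I_n}) (c e : R) :
  [disjoint A & B] -> filter_bound phi A c -> filter_bound phi B e ->
  filter_bound phi (A :|: B) (c + e).
Proof.
move=> dAB hA hB a ha x; rewrite subsumU//.
by apply: (le_trans (ler_normD _ _)); rewrite lerD ?hA ?hB.
Qed.

(** Averaging the translates by [2 pi j / q] with weights [2 cos (2 pi g j / q)] keeps the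
    frequencies congruent to [g] or [-g] modulo [q]. The multiplicity [e] is [2] when these two
    classes coincide and [1] when they are distinct. *)
Lemma filter_bound_residues (R : realType) (n : nat) (phi : 'I_n -> R)
    (A : {set 'I_n}) (q g e : nat) : (0 < q)%N -> (0 < e)%N ->
  (forall k : 'I_n, (k.+1 == g %[mod q]) + (k.+1 + g == 0 %[mod q]) =
    e * (k \in A) :> nat)%N ->
  filter_bound phi A (2 / e%:R).
Proof.
move=> q0 e0 hA a ha x.
have q0' : 0 < q%:R :> R by rewrite ltr0n.
have e0' : 0 < e%:R :> R by rewrite ltr0n.
pose b (j : nat) : R := j%:R * (2 * pi / q%:R).
have key : \sum_(j < q) 2 * cos (g%:R * b j) * subsum a phi [set: 'I_n] (x + b j) =
    q%:R * e%:R * subsum a phi A x.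
  under eq_bigr => j _ do rewrite mulr_sumr.
  rewrite exchange_big /= mulr_sumr [RHS]big_mkcond /=.
  apply: eq_big => [k|k _]; first by rewrite inE.
  set t := k.+1%:R * x + phi k.
  (* Product-to-sum; the difference with [0%N%:R] gives the second sum the shape of
     [sum_cos_roots]. *)
  transitivity (a k * (\sum_(j < q) cos (t + (k.+1%:R - g%:R) * b j) +
                       \sum_(j < q) cos (t + ((k.+1 + g)%N%:R - 0%N%:R) * b j))).
    rewrite -big_split mulr_sumr; apply: eq_bigr => j _ /=.
    have -> : k.+1%:R * (x + b j) + phi k = t + k.+1%:R * b j by rewrite /t; ring.
    have -> : t + (k.+1%:R - g%:R) * b j = (t + k.+1%:R * b j) - g%:R * b j by ring.
    have -> : t + ((k.+1 + g)%N%:R - 0%N%:R) * b j = (t + k.+1%:R * b j) + g%:R * b j.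
      by rewrite natrD; ring.
    by set u := t + _; set v := g%:R * _; rewrite (cosD u v) (cosB u v); ring.
  have ifE (c : bool) (y : R) : (if c then y else 0) = c%:R * y.
    by case: c; rewrite ?mul1r ?mul0r.
  rewrite !sum_cos_roots// !ifE.
  rewrite -mulrDl -natrD (hA k) natrM; ring.
have : `|q%:R * e%:R * subsum a phi A x| <= q%:R * 2.
  rewrite -key; apply: (le_trans (ler_norm_sum _ _ _)).
  rewrite -[leRHS](_ : \sum_(j < q) 2 = _); last by rewrite sumr_const card_ord mulr_natl.
  apply: ler_sum => j _; rewrite !normrM (ger0_norm (ler0n _ 2)).
  rewrite -mulrA ler_piMr// mulr_ile1//; exact: cos_max.
rewrite !normrM !normr_nat -mulrA ler_pM2l// mulrC => h.
by rewrite ler_pdivlMr.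
Qed.

(** * Mean squares and the size of the coefficients *)

Lemma cos_prod_mean (R : realType) (k l q : nat) (s t : R) :
  (0 < k)%N -> (0 < l)%N -> (k + l < q)%N ->
  \sum_(j < q) cos (k%:R * (j%:R * (2 * pi / q%:R)) + s) *
               cos (l%:R * (j%:R * (2 * pi / q%:R)) + t) =
  if k == l then q%:R / 2 * cos (s - t) else 0.
Proof.
move=> k0 l0 klq; have q0 : (0 < q)%N by lia.
pose b (j : nat) : R := j%:R * (2 * pi / q%:R).
transitivity (2^-1 * (\sum_(j < q) cos ((s - t) + (k%:R - l%:R) * b j) +
                      \sum_(j < q) cos ((s + t) + ((k + l)%N%:R - 0%N%:R) * b j))).
  rewrite -big_split mulr_sumr; apply: eq_bigr => j _ /=; rewrite -/(b j).
  have -> : s - t + (k%:R - l%:R) * b j = (k%:R * b j + s) - (l%:R * b j + t) by ring.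
  have -> : s + t + ((k + l)%N%:R - 0%N%:R) * b j = (k%:R * b j + s) + (l%:R * b j + t).
    by rewrite natrD; ring.
  set u := _ + s; set v := _ + t; rewrite (cosD u v) (cosB u v).
  by field.
rewrite !sum_cos_roots//.
(* No aliasing: [0 < k + l < q]. *)
have -> : (k + l == 0 %[mod q]) = false by rewrite mod0n modn_small//; lia.
have -> : (k == l %[mod q]) = (k == l) by rewrite !modn_small//; lia.
by case: ifP => _; [field | rewrite addr0 mulr0].
Qed.

(** Discrete Parseval identity. It is exact on [2n + 1] equally spaced points because two
    frequencies add up to at most [2n]. *)
Lemma sum_coef_sqr_le (R : realType) (n : nat) (a phi : 'I_n -> R) (B : R) :
  (forall x, `|subsum a phi [set: 'I_n] x| <= B) -> \sum_k a k ^+ 2 <= 2 * B ^+ 2.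
Proof.
move=> ha; pose q := n.*2.+1.
pose b (j : nat) : R := j%:R * (2 * pi / q%:R).
have q0 : 0 < q%:R :> R by rewrite ltr0n.
have key : \sum_(j < q) (subsum a phi [set: 'I_n] (b j)) ^+ 2 =
    q%:R / 2 * \sum_k a k ^+ 2.
  under eq_bigr => j _ do rewrite expr2 mulr_suml.
  rewrite exchange_big /= mulr_sumr; apply: eq_big => [k|k _]; first by rewrite inE.
  under eq_bigr => j _ do rewrite mulr_sumr.
  rewrite exchange_big /= (bigD1 k) ?inE//= [X in _ + X]big1 => [|l /andP[_ lk]].
    rewrite addr0; under eq_bigr => j _ do rewrite mulrACA.
    rewrite -mulr_sumr cos_prod_mean ?eqxx ?subrr ?cos0//; last first.
      by move: (ltn_ord k); rewrite /q; lia.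
    by rewrite mulr1 -expr2 mulrC.
  under eq_bigr => j _ do rewrite mulrACA.
  rewrite -mulr_sumr cos_prod_mean//; last by move: (ltn_ord k) (ltn_ord l); rewrite /q; lia.
  by rewrite eqSS eq_sym (negPf lk : (l == k :> nat) = false) mulr0.
have : q%:R / 2 * \sum_k a k ^+ 2 <= q%:R * B ^+ 2.
  rewrite -key mulr_natl -[X in _ *+ X](card_ord q) -sumr_const.
  apply: ler_sum => j _; rewrite -real_normK ?num_real//.
  by rewrite lerXn2r ?nnegrE//; exact: le_trans (ha 0).
by rewrite -mulrA ler_pM2l// mulrC ler_pdivrMr// [in leRHS]mulrC.
Qed.

(** * Multiples and odd multiples: counting, filtering, greedy choice *)

Definition multiples (n c : nat) : {set 'I_n} := [set k : 'I_n | (c %| k.+1)%N].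

(** Being an odd multiple of [c] is being congruent to [-c] modulo [2c]: a single residue class,
    ready for counting and filtering. *)
Definition odd_multiples (n c : nat) : {set 'I_n} := [set k : 'I_n | (c.*2 %| k.+1 + c)%N].

(** This counts the multiples of [q] in the interval from [g + 1] to [n + g]; the additive form
    avoids truncated subtraction. *)
Lemma card_dvdn_add (n q g : nat) : (0 < q)%N ->
  (#|[set k : 'I_n | (q %| k.+1 + g)%N]| + g %/ q = (n + g) %/ q)%N.
Proof.
move=> q0.
have -> : #|[set k : 'I_n | (q %| k.+1 + g)%N]| = (\sum_(k < n) (q %| k.+1 + g))%N.
  by rewrite -sum1_card big_mkcond /=; apply: eq_bigr => k _; rewrite inE; case: ifP.
elim: n => [|n IH]; first by rewrite big_ord0.
by rewrite big_ord_recr /= addnAC IH addSn divnS// addnC.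
Qed.

Lemma card_multiples (n q : nat) : (0 < q)%N -> #|multiples n q| = (n %/ q)%N.
Proof.
move=> q0; have := card_dvdn_add n 0 q0; rewrite div0n !addn0 => <-.
by apply: eq_card => k; rewrite !inE addn0.
Qed.

Lemma card_odd_multiples (n c : nat) : (0 < c)%N ->
  (c.*2 * #|odd_multiples n c| <= n + c /\ n < c.*2 * #|odd_multiples n c| + c)%N.
Proof.
move=> c0; have c20 : (0 < c.*2)%N by rewrite double_gt0.
have := card_dvdn_add n c c20; rewrite (divn_small (_ : c < c.*2)%N); last by lia.
rewrite addn0 -/(odd_multiples n c) => ->.
by have := leq_trunc_div (n + c) c.*2; have := ltn_ceil (n + c) c20; lia.
Qed.

Lemma odd_multiplesE (n c : nat) (k : 'I_n) : (0 < c)%N ->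
  (k \in odd_multiples n c) = (c %| k.+1)%N && ~~ (c.*2 %| k.+1)%N.
Proof.
move=> c0; rewrite inE; case: (boolP (c %| k.+1)%N) => [/dvdnP[y ->]|nck] /=.
  rewrite -[X in (_ + X)%N]mul1n -mulnDl -mul2n !dvdn_pmul2r// !dvdn2 negbK.
  by rewrite addn1 /= negbK.
apply: contraNF nck => h; have : (c %| k.+1 + c)%N.
  by apply: dvdn_trans h; rewrite -mul2n dvdn_mull.
by rewrite dvdn_addl.
Qed.

Lemma filter_bound_multiples (R : realType) (n q : nat) (phi : 'I_n -> R) :
  (0 < q)%N -> filter_bound phi (multiples n q) 1.
Proof.
move=> q0; rewrite -[1](divff (_ : 2%:R != 0)) ?pnatr_eq0//.
apply: (filter_bound_residues (q := q) (g := 0)) => // k.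
by rewrite addn0 inE mod0n -/(dvdn _ _) addnn mul2n.
Qed.

(** Modulo [2c] the residues [c] and [-c] coincide, so [e = 2] and the class costs only [1]. *)
Lemma filter_bound_odd_multiples (R : realType) (n c : nat) (phi : 'I_n -> R) :
  (0 < c)%N -> filter_bound phi (odd_multiples n c) 1.
Proof.
move=> c0; rewrite -[1](divff (_ : 2%:R != 0)) ?pnatr_eq0//.
apply: (filter_bound_residues (q := c.*2) (g := c)) => //; first by rewrite double_gt0.
move=> k; rewrite -(eqn_modDr c) addnn modnn mod0n inE -/(dvdn _ _).
by rewrite addnn mul2n.
Qed.

(* As a is the first odd number whose class fits, the remainder is at most the
   gap between the densities 1 / (2 c (a - 2)) and 1 / (2 c a), where a >= w. *)
Lemma greedy_step (n c w r : nat) : (0 < c)%N -> (10 <= w)%N ->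
  (r * c.*2 * w <= n)%N -> (c * w ^ 2 <= n)%N ->
  exists a, [/\ odd a, (#|odd_multiples n (c * a)| <= r)%N &
    ((r - #|odd_multiples n (c * a)|) * (4 * c) * w ^ 2 <= 5 * n)%N].
Proof.
move=> c0 w10 hr hw.
pose P a := odd a && (#|odd_multiples n (c * a)| <= r)%N.
have exP : exists a, P a.
  (* For this [a] the class is empty, as [c * a] exceeds [n]. *)
  exists n.*2.+1; rewrite /P /= odd_double /=.
  have [|h _] := @card_odd_multiples n (c * n.*2.+1); first by rewrite muln_gt0 c0.
  apply: leq_trans (leq0n r); rewrite leqn0; case: #|_| h => // t; nia.
case: (ex_minnP exP) => a /andP[oa ta] amin; exists a; split => //.
have a0 : (0 < a)%N by case: (a) oa.
have [|h1 h2] := @card_odd_multiples n (c * a); first by rewrite muln_gt0 c0.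
(* If [a < w], the hypotheses combine to [w ^ 2 < a * (w + 1)], which contradicts [a <= w - 1]. *)
have wa : (w <= a)%N.
  rewrite leqNgt; apply/negP => aw.
  have h3 : (n < c * a * (2 * r + 1))%N by nia.
  have h4 : (w * (c * a * (2 * r + 1)) <= a * n + c * a * w)%N by nia.
  have h5 : (c * a * w * w <= n * a)%N by nia.
  move: hw hr h1 h2 => _ _ _ _.
  have h6 : (w * n < a * n + c * a * w)%N by nia.
  have h7 : (w * w * n < a * n * w + n * a)%N by nia.
  have h8 : (w * w < a * w.+1)%N by nia.
  by nia.
have [|g1 _] := @card_odd_multiples n (c * (a - 2)).
  by rewrite muln_gt0 c0; lia.
have hbig : (r < #|odd_multiples n (c * (a - 2))|)%N.
  rewrite ltnNge; apply/negP => h.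
  have : P (a - 2)%N by rewrite /P h andbT oddB ?oa//; lia.
  by move/amin; lia.
move: g1 hbig h2 ta; set s := #|_|; set t := #|_| => g1 hbig h2 ta.
have [b ab] : exists b, a = (b + 2)%N by exists (a - 2)%N; lia.
have [u ru] : exists u, r = (t + u)%N by exists (r - t)%N; lia.
move: g1 h2 hbig; rewrite ab ru addKn addnK => g1 h2 hbig.
have k1 : (2 * (c * b) * (t + u).+1 <= n + c * b)%N.
  by apply: leq_trans g1; rewrite -!mul2n leq_mul2l hbig orbT.
have k2 : (n < 2 * (c * (b + 2)) * t + c * (b + 2))%N by rewrite mul2n.
(* Adding [b + 2] times [k1] to [b] times [k2] eliminates [t] and leaves twice this inequality. *)
have k3 : (c * b * (b + 2) * u <= n)%N.
  have := leq_mul (leqnn (b + 2)) k1.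
  have := leq_mul (leqnn b) (ltnW k2).
  by move=> {}k1 {}k2; nia.
(* Since [b >= w - 2], this follows from [4 w <= 5 (w - 2)], that is, from [10 <= w]. *)
have k4 : (4 * w ^ 2 <= 5 * (b * (b + 2)))%N.
  have wb : (w <= b + 2)%N by rewrite -ab.
  have [v wv] : exists v, w = (v + 10)%N by exists (w - 10)%N; lia.
  have vb : (v + 8 <= b)%N by lia.
  by have := leq_mul vb wb; rewrite wv expnS expn1 => hh; nia.
have k5 := leq_mul k4 (leqnn (c * u)).
have k6 : (5 * (c * b * (b + 2) * u) <= 5 * n)%N by rewrite leq_mul2l k3 orbT.
apply: leq_trans k6; apply: leq_trans (_ : 4 * w ^ 2 * (c * u) <= _)%N; first by lia.
by apply: leq_trans k5 _; lia.
Qed.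

(** * Filling with odd residues modulo 256, then with greedy classes *)

(** For [g < 64] these are the two distinct residues of [2g + 1] and [-(2g + 1)] modulo 256. *)
Definition odd_pair_class (n g : nat) : {set 'I_n} :=
  [set k : 'I_n | (k.+1 %% 256 == g.*2.+1)%N || (k.+1 %% 256 == 255 - g.*2)%N].

Lemma filter_bound_odd_pair_class (R : realType) (n g : nat) (phi : 'I_n -> R) :
  (g < 64)%N -> filter_bound phi (odd_pair_class n g) 2.
Proof.
move=> g64; rewrite (_ : 2 = 2 / 1%:R); last by rewrite divr1.
apply: (filter_bound_residues (q := 256) (g := g.*2.+1)) => // k.
by rewrite inE; lia.
Qed.

Lemma card_odd_pair_class (n g : nat) :
  (g < 64)%N -> (#|odd_pair_class n g| * 128 <= n + 256)%N.
Proof.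
move=> g64.
have := card_dvdn_add n g.*2.+1 (isT : 0 < 256)%N.
have := card_dvdn_add n (255 - g.*2) (isT : 0 < 256)%N.
set A := [set _ | _]; set B := [set _ | _] => hA hB.
have : (#|odd_pair_class n g| <= #|A :|: B|)%N.
  by apply: subset_leq_card; apply/fintype.subsetP => k; rewrite !inE; lia.
by have := (leq_card_setU A B).1; lia.
Qed.

(* The classes of ±1, ±3, ..., ±(2j-1) modulo 256. *)
Definition odd_residues (n j : nat) : {set 'I_n} :=
  [set k : 'I_n | odd k.+1 && ((k.+1 %% 256 < j.*2) || (256 - j.*2 < k.+1 %% 256))%N].

Lemma odd_residuesS (n j : nat) : (j < 64)%N ->
  odd_residues n j.+1 = odd_residues n j :|: odd_pair_class n j /\
  [disjoint odd_residues n j & odd_pair_class n j].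
Proof.
move=> j64; split; first by apply/finset.setP => k; rewrite !inE; lia.
rewrite -finset.setI_eq0; apply/eqP/setP => k; rewrite !inE; lia.
Qed.

Lemma filter_bound_odd_residues (R : realType) (n j : nat) (phi : 'I_n -> R) :
  (j <= 64)%N -> filter_bound phi (odd_residues n j) (2 * j%:R).
Proof.
elim: j => [_|j IH j64].
  have -> : odd_residues n 0 = finset.set0 by apply/finset.setP => k; rewrite !inE; lia.
  by rewrite mulr0; exact: filter_bound0.
have [-> dj] := odd_residuesS n j64.
rewrite -(natr1 j) mulrDr mulr1; apply: filter_boundU => //; first by apply: IH; lia.
exact: filter_bound_odd_pair_class.
Qed.

(** Pairs of residues are added until the next one would overflow [m]. A pair has at most
    [(n + 256) / 128] elements, which is at most [n / 80] once [n >= 427]; the 64 pairs cost at most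
    [2 * 64 = 128]. The factor [80 = 4 * 5 * 4] is what [egyptian_fill] needs at [J = 0]. *)
Lemma odd_fill (R : realType) (n m : nat) (phi : 'I_n -> R) :
  (427 <= n)%N -> (2 * m <= n)%N ->
  exists A : {set 'I_n}, [/\ forall k, k \in A -> odd k.+1,
    filter_bound phi A 128, (#|A| <= m)%N & ((m - #|A|) * 80 <= n)%N].
Proof.
move=> n427 mn.
have odd_res j (k : 'I_n) : k \in odd_residues n j -> odd k.+1 by rewrite inE => /andP[].
have bound128 j : (j <= 64)%N -> filter_bound phi (odd_residues n j) 128.
  move=> j64 a ha x; apply: (le_trans (filter_bound_odd_residues j64 ha x)).
  by rewrite (natrM _ 2 64) ler_pM2l// ler_nat.
suff H j : (j <= 64)%N -> (#|odd_residues n j| <= m)%N \/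
    exists A : {set 'I_n}, [/\ forall k, k \in A -> odd k.+1,
    filter_bound phi A 128, (#|A| <= m)%N & ((m - #|A|) * 80 <= n)%N].
  have [h|//] := H 64%N isT.
  (* If all 64 pairs fit, every odd index is taken; there are at least [n / 2 >= m] of them, so
     nothing remains. *)
  exists (odd_residues n 64); split => //; [exact: odd_res | exact: bound128 |].
  have [|_] := @card_odd_multiples n 1 => //.
  have -> : odd_multiples n 1 = odd_residues n 64; last by lia.
  by apply/finset.setP => k; rewrite !inE; lia.
elim: j => [_|j IH j64].
  left; have -> : odd_residues n 0 = finset.set0 by apply/finset.setP => k; rewrite !inE; lia.
  by rewrite cards0.
case: IH => [|jm|]; [by lia| |by right].
have [jm'|mj] := leqP #|odd_residues n j.+1| m; [by left|right].
exists (odd_residues n j); split => //; [exact: odd_res | by apply: bound128; lia |].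
have [E _] := odd_residuesS n j64; move: mj; rewrite E => mj.
have := (leq_card_setU (odd_residues n j) (odd_pair_class n j)).1.
have := card_odd_pair_class n j64; lia.
Qed.

(** One greedy class per unit of [J]. The power of 2 in the first conclusion leaves the multiples of
    [2 ^ J.+1] free for later classes, and the factor [2 ^ (2 ^ J.+1)] is squared at each step. *)
Lemma egyptian_fill (R : realType) (n m J : nat) (phi : 'I_n -> R) :
  (427 <= n)%N -> (2 * m <= n)%N ->
  (2 ^ J * (5 * 2 ^ (2 ^ J)) ^ 2 <= n)%N ->
  exists A : {set 'I_n}, [/\ forall k, k \in A -> ~~ (2 ^ J.+1 %| k.+1)%N,
    filter_bound phi A (128 + J%:R), (#|A| <= m)%N &
    ((m - #|A|) * 2 ^ J.+2 * (5 * 2 ^ (2 ^ J.+1)) <= n)%N].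
Proof.
move=> n427 mn; elim: J => [_|J IH hJ].
  have [A [Aodd Ab Am hA]] := odd_fill phi n427 mn.
  exists A; split => //; [by move=> k /Aodd; rewrite dvdn2 negbK | by rewrite addr0 |].
  by apply: leq_trans hA; rewrite -mulnA.
have W2 i : ((2 ^ (2 ^ i)) ^ 2 = 2 ^ (2 ^ i.+1))%N by rewrite -expnM -expnSr.
have Wmono : (2 ^ (2 ^ J) <= 2 ^ (2 ^ J.+1))%N by rewrite leq_exp2l// leq_exp2l.
have [|A [AJ Ab Am hA]] := IH.
  apply: leq_trans hJ; apply: leq_mul; first by rewrite leq_exp2l.
  by rewrite leq_exp2r// leq_mul2l.
pose c := (2 ^ J.+1)%N; pose w := (5 * 2 ^ (2 ^ J.+1))%N.
have c0 : (0 < c)%N by rewrite expn_gt0.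
have [|||a [oa ta ha]] := @greedy_step n c w (m - #|A|) c0.
- have : (2 ^ 1 <= 2 ^ (2 ^ J.+1))%N by rewrite leq_exp2l// expn_gt0.
  by rewrite /w; lia.
- by move: hA; rewrite -/w (expnS 2 J.+1) -/c mul2n.
- exact: hJ.
have a0 : (0 < a)%N by case: (a) oa.
have ca0 : (0 < c * a)%N by rewrite muln_gt0 c0.
(* The new class consists of multiples of [2 ^ J.+1], which [A] avoids. *)
have dAO : [disjoint A & odd_multiples n (c * a)].
  apply/pred0P => k /=; apply/negP => /andP[/AJ/negP kA].
  rewrite odd_multiplesE// => /andP[h _]; apply: kA.
  by apply: dvdn_trans h; exact: dvdn_mulr.
exists (A :|: odd_multiples n (c * a)).
have cardE : #|A :|: odd_multiples n (c * a)| = (#|A| + #|odd_multiples n (c * a)|)%N.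
  by rewrite cardsU (disjoint_setI0 dAO) cards0 subn0.
split.
- move=> k; rewrite inE => /orP[/AJ|].
    by apply: contra => h; apply: dvdn_trans h; rewrite dvdn_exp2l.
  rewrite odd_multiplesE// => /andP[h]; apply: contra => h'.
  (* As [a] is odd, divisibility by [2 ^ J.+2] and by [a] would give divisibility by [2 * c * a]. *)
  rewrite -mul2n mulnA (_ : 2 * c = 2 ^ J.+2)%N ?(expnS 2 J.+1)//.
  rewrite Gauss_dvd ?h' ?(dvdn_trans _ h) ?dvdn_mull//.
  by rewrite -expnS coprimeXl// coprime2n.
- rewrite -(natr1 J) addrA; apply: filter_boundU => //.
  exact: filter_bound_odd_multiples.
- by rewrite cardE; lia.
(* The factor 5 in [w] reproduces itself: squaring gives 25, and [greedy_step] loses 5. *)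
- rewrite cardE subnDA -W2.
  move: ha; rewrite /w expnMn => ha.
  rewrite -(@leq_pmul2l 5)//; apply: leq_trans ha.
  by rewrite (expnS 2 J.+2) (expnS 2 J.+1) -/c; lia.
Qed.

(** * Exponential moments and random sampling *)

Lemma expR_le_quadratic (R : realType) (u : R) : `|u| <= 1 -> expR u <= 1 + u + 2 * u ^+ 2.
Proof.
rewrite ler_norml => /andP[ul uu].
have E : expR u * expR (- u) = 1 by rewrite expRxMexpNx_1.
have p0 := expR_gt0 u; have q0 := expR_gt0 (- u).
suff : 1 <= (1 + u + 2 * u ^+ 2) * expR (- u) by rewrite -E ler_pM2r.
have s0 : 0 <= 1 + u + 2 * u ^+ 2 by nra.
have [u0|u0] := lerP u 0.
  have h : 1 - u <= expR (- u) by apply: expR_ge1Dx.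
  by apply: (le_trans _ (ler_wpM2l s0 h)); nra.
(* For positive [u] the bound [1 - u] is too weak, as it vanishes at [u = 1]; the square of the
   linear bound at [u / 2] suffices. *)
have h2 : (1 - u / 2) ^+ 2 <= expR (- u).
  have -> : - u = 2%:R * (- (u / 2)) by field.
  rewrite expRM_natl lerXn2r ?nnegrE ?expR_ge0//; first by lra.
  exact: expR_ge1Dx.
apply: (le_trans _ (ler_wpM2l s0 h2)).
have -> : (1 + u + 2 * u ^+ 2) * (1 - u / 2) ^+ 2 =
  1 + u ^+ 2 * ((1 - u) * (5 / 4 - u / 2)) by field.
by rewrite lerDl mulr_ge0 ?sqr_ge0// mulr_ge0//; lra.
Qed.

Lemma subset_of_card (T : finType) (A : {set T}) (b : nat) :
  (b <= #|A|)%N -> exists2 B : {set T}, B \subset A & #|B| = b.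
Proof.
move=> bA; exists [set x : T in take b (enum A)].
  by apply/fintype.subsetP => x; rewrite inE => /mem_take; rewrite mem_enum.
rewrite cardsE; have /card_uniqP -> : uniq (take b (enum A)) by rewrite take_uniq ?enum_uniq.
by rewrite size_take -cardE; case: ltngtP bA => // ->.
Qed.

Lemma exists_le_mean (R : realType) (I : finType) (B : {set I}) (F : I -> R) (M : R) :
  (0 < #|B|)%N -> \sum_(c in B) F c <= #|B|%:R * M -> exists2 c, c \in B & F c <= M.
Proof.
move=> B0 hF; have [c cB] := card_gt0P B0.
exists [arg min_(i < c in B) F i]%O; first by case: arg_minP.
case: arg_minP => // i iB imin.
rewrite -(@ler_pM2l _ #|B|%:R) ?ltr0n//; apply: le_trans hF.
by rewrite mulr_natl -sumr_const ler_sum.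
Qed.

(** One element is drawn from each of [m] blocks of size [b], by conditional expectations. The
    weight [w] carries the bounds for the blocks already set aside, which lets the induction go
    through. *)
Lemma block_sampling (R : realType) (Y I : finType) (v : I -> Y -> R) (b : nat) :
  (0 < b)%N -> forall (m : nat) (G : {set I}) (w : Y -> R),
  #|G| = (m * b)%N -> (forall y, 0 <= w y) ->
  exists T : {set I}, [/\ T \subset G, #|T| = m &
    \sum_y w y * expR (\sum_(k in T) v k y) <=
    \sum_y w y * expR (b%:R^-1 * \sum_(k in G) (expR (v k y) - 1))].
Proof.
move=> b0; have b0' : 0 < b%:R :> R by rewrite ltr0n.
elim=> [|m IH] G w cG w0.
  exists finset.set0; rewrite cards0 finset.sub0set; split => //.
  move/eqP: cG; rewrite mul0n cards_eq0 => /eqP ->.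
  by apply: ler_sum => y _; rewrite !big_set0 mulr0.
have [|B BG cB] := @subset_of_card _ G b; first by rewrite cG leq_pmull.
pose e y := expR (b%:R^-1 * \sum_(k in B) (expR (v k y) - 1)).
have [||T [TG cT hT]] := IH (G :\: B) (fun y => w y * e y).
- by rewrite cardsD (finset.setIidPr BG) cG cB mulSn addKn.
- by move=> y; rewrite mulr_ge0 ?expR_ge0.
pose F c := \sum_y w y * expR (\sum_(k in T) v k y) * expR (v c y).
have [||c cBin hc] := @exists_le_mean R I B F
    (\sum_y w y * e y * expR (\sum_(k in T) v k y)).
- by rewrite cB.
- rewrite /F exchange_big mulr_sumr cB; apply: ler_sum => y _ /=.
  set E := expR (\sum_(k in T) _); rewrite -mulr_sumr.
  have -> : b%:R * (w y * e y * E) = w y * E * (b%:R * e y) by ring.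
  rewrite ler_wpM2l ?mulr_ge0 ?expR_ge0//.
  (* [1 + x <= expR x] bounds the mean over [B] of [expR (v k y)] by [e y]. *)
  have := expR_ge1Dx (b%:R^-1 * \sum_(k in B) (expR (v k y) - 1)).
  rewrite -/(e y) => /(ler_wpM2l (ltW b0')); rewrite mulrDr mulr1 mulVKf ?gt_eqF//.
  by rewrite sumrB sumr_const cB addrC subrK.
have cT' : c \notin T.
  by apply/negP => /(fintype.subsetP TG); rewrite inE cBin.
exists (c |: T); split.
- rewrite finset.subUset finset.sub1set (fintype.subsetP BG c cBin) /=.
  by apply: fintype.subset_trans TG _; exact: finset.subsetDl.
- by rewrite cardsU1 cT' cT.
have -> : \sum_y w y * expR (\sum_(k in c |: T) v k y) = F c.
  by apply: eq_bigr => y _; rewrite big_setU1//= expRD mulrA mulrAC.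
apply: (le_trans hc); apply: (le_trans hT).
apply: ler_sum => y _; rewrite -mulrA ler_wpM2l// /e -expRD -mulrDr.
rewrite [X in _ <= expR (_ * X)](big_setID B) /=.
by rewrite (finset.setIidPr BG).
Qed.

(* One element is drawn from each of m blocks of equal size; the |H| mod m
   elements left over are themselves obtained by induction, so that the mean of
   the draw stays controlled. *)
Lemma sampling (R : realType) (Y I : finType) (v : I -> Y -> R) (L : nat)
    (H : {set I}) (c : R) :
  (2 <= L)%N -> #|Y|%:R <= expR L%:R :> R -> 0 <= c ->
  (forall k y, k \in H -> L%:R * `|v k y| <= 1) ->
  (forall y, \sum_(k in H) v k y ^+ 2 <= 2) ->
  (forall y, `|\sum_(k in H) v k y| <= c * L%:R) ->
  forall m : nat, (m * L <= #|H|)%N ->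
  exists T : {set I}, [/\ T \subset H, #|T| = m &
    forall y, `|\sum_(k in T) v k y| <= 2 * c + 11].
Proof.
move=> L2 cY c0 vsmall vsqr vsum; elim/ltn_ind => m IH mL.
have [->|m0] := posnP m.
  exists finset.set0; rewrite cards0 finset.sub0set; split=> // y.
  by rewrite big_set0 normr0; lra.
have L2' : 2 <= L%:R :> R by rewrite ler_nat.
have L0 : 0 < L%:R :> R by lra.
pose b := (#|H| %/ m)%N; have Lb : (L <= b)%N by rewrite leq_divRL// mulnC.
have b0 : (0 < b)%N by lia.
have [||T0 [T0H cT0 hT0]] := IH (#|H| %% m)%N.
- by rewrite ltn_mod.
- by apply: leq_trans mL; rewrite leq_mul2r ltnW ?orbT ?ltn_mod.
(* The Boolean is a sign, so that one-sided exponential bounds control absolute values; [L] is the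
   scale of the exponential moment. *)
pose u (k : I) (z : Y * bool) : R := L%:R * ((-1) ^+ z.2 * v k z.1).
have cG : #|H :\: T0| = (m * b)%N.
  by rewrite cardsD (finset.setIidPr T0H) cT0 mulnC {1}(divn_eq #|H| m) addnK.
have [|T [TG cT hT]] := block_sampling u b0 cG (w := fun=> 1); first by [].
have GH : H :\: T0 \subset H by exact: finset.subsetDl.
exists T; split => //; first exact: fintype.subset_trans TG GH.
(* The summands come from the sum over [H], from the leftover [T0], and from the quadratic term of
   the exponential bound. *)
pose M := c * L%:R + (2 * c + 11) + 4 * L%:R.
have bound z : b%:R^-1 * (\sum_(k in H :\: T0) (expR (u k z) - 1)) <= M.
  have ineq k : k \in H :\: T0 -> expR (u k z) - 1 <= u k z + 2 * u k z ^+ 2.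
    move=> kG; have := @expR_le_quadratic R (u k z); rewrite lerBlDl addrA; apply.
    rewrite /u normrM normr_nat normrM normrX normrN1 expr1n mul1r.
    by apply: vsmall; exact: (fintype.subsetP GH).
  have s1 : \sum_(k in H :\: T0) u k z <= L%:R * (c * L%:R + (2 * c + 11)).
    rewrite -!mulr_sumr ler_wpM2l ?ler0n//.
    apply: (le_trans (ler_norm _)); rewrite normrM normrX normrN1 expr1n mul1r.
    have -> : \sum_(k in H :\: T0) v k z.1 =
        \sum_(k in H) v k z.1 - \sum_(k in T0) v k z.1.
      by rewrite [X in _ = X - _](big_setID T0) /= (finset.setIidPr T0H) addrAC subrr add0r.
    by apply: (le_trans (ler_normB _ _)); rewrite lerD.
  have s2 : \sum_(k in H :\: T0) u k z ^+ 2 <= L%:R * (2 * L%:R).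
    have -> : \sum_(k in H :\: T0) u k z ^+ 2 =
        L%:R ^+ 2 * \sum_(k in H :\: T0) v k z.1 ^+ 2.
      rewrite mulr_sumr; apply: eq_bigr => k _.
      by rewrite /u !exprMn sqrr_sign mul1r.
    have -> : L%:R * (2 * L%:R) = L%:R ^+ 2 * 2 :> R by ring.
    rewrite ler_wpM2l ?sqr_ge0//; apply: le_trans (vsqr z.1).
    rewrite [leRHS](big_setID T0) /= (finset.setIidPr T0H).
    by rewrite lerDr sumr_ge0// => k _; rewrite sqr_ge0.
  have s3 : \sum_(k in H :\: T0) (expR (u k z) - 1) <= L%:R * M.
    apply: (le_trans (ler_sum _ ineq)); rewrite big_split /=.
    rewrite /M; have -> : L%:R * (c * L%:R + (2 * c + 11) + 4 * L%:R) =
       L%:R * (c * L%:R + (2 * c + 11)) + 2 * (L%:R * (2 * L%:R)) :> R by ring.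
    by apply: lerD => //; rewrite -mulr_sumr ler_pM2l.
  have b0' : 0 < b%:R :> R by rewrite ltr0n.
  rewrite mulrC ler_pdivrMr// mulrC; apply: (le_trans s3).
  rewrite ler_wpM2r ?ler_nat// /M.
  have : 0 <= c * L%:R by rewrite mulr_ge0// ltW.
  by lra.
have total : \sum_z expR (\sum_(k in T) u k z) <= expR (1 + L%:R + M).
  under eq_bigr => z _ do rewrite -[expR _]mul1r.
  apply: (le_trans hT).
  apply: (@le_trans _ _ (\sum_(z : Y * bool) expR M)).
    by apply: ler_sum => z _; rewrite mul1r ler_expR.
  rewrite sumr_const -(mulr_natl (expR M)) card_prod card_bool natrM.
  rewrite (expRD _ M) ler_wpM2r ?expR_ge0// addrC expRD ler_pM//.
  by have := expR_ge1Dx (1 : R); lra.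
have single z : \sum_(k in T) u k z <= 1 + L%:R + M.
  rewrite -ler_expR; apply: le_trans total.
  by rewrite (bigD1 z)//= lerDl sumr_ge0// => i _; rewrite expR_ge0.
have signed y (s : bool) : (-1) ^+ s * \sum_(k in T) v k y <= 2 * c + 11.
  rewrite -(ler_pM2l L0); have := single (y, s).
  (* The constant 11 closes the induction: [1 + L + M = (c + 5) L + 2 c + 12] is at most
     [(2 c + 11) L] as soon as [L >= 2]. *)
  rewrite /u -!mulr_sumr /= => h; apply: (le_trans h); rewrite /M.
  by nra.
move=> y; rewrite ler_norml; apply/andP; split.
  by have := signed y true; rewrite expr1 mulN1r; lra.
by have := signed y false; rewrite expr0 mul1r.
Qed.

(** * From a finite grid to the whole circle *)

Lemma cos_lipschitz (R : realType) (x y : R) : `|cos x - cos y| <= `|x - y|.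
Proof.
wlog xy : x y / y <= x => [H|].
  by have [yx|xy] := leP y x; [exact: H | rewrite distrC (distrC x); apply/H/ltW].
have hd (t : R) : t \in `]y, x[ -> is_derive t 1 (@cos R) (- sin t).
  by move=> _; exact: is_derive_cos.
have hc : {within `[y, x]%classic, continuous (@cos R)}%classic.
  by apply: continuous_subspaceT => t; exact: continuous_cos.
have [c _ ->] := MVT_segment xy hd hc.
by rewrite normrM normrN ler_piMl ?sin_max.
Qed.

Lemma subsum_periodic (R : realType) (n : nat) (a phi : 'I_n -> R) (A : {set 'I_n})
    (x : R) (z : int) : subsum a phi A (x + z%:~R * (2 * pi)) = subsum a phi A x.
Proof.
apply: periodicz => {}x; apply: eq_bigr => k _; congr (_ * _).
by rewrite -[RHS](cosD2piz _ k.+1%N) -pmulrn; congr cos; ring.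
Qed.

Lemma subsum_lipschitz (R : realType) (n : nat) (a phi : 'I_n -> R) (A : {set 'I_n})
    (x y : R) : (forall k, `|a k| <= 2) ->
  `|subsum a phi A x - subsum a phi A y| <= 2 * n%:R ^+ 2 * `|x - y|.
Proof.
move=> ha; rewrite -sumrB; apply: (le_trans (ler_norm_sum _ _ _)).
apply: (@le_trans _ _ (\sum_(k in A) 2 * (n%:R * `|x - y|))).
  apply: ler_sum => k _; rewrite -mulrBr normrM ler_pM//.
  apply: (le_trans (cos_lipschitz _ _)).
  have -> : k.+1%:R * x + phi k - (k.+1%:R * y + phi k) = k.+1%:R * (x - y) by ring.
  by rewrite normrM normr_nat ler_wpM2r// ler_nat.
rewrite sumr_const -(mulr_natl (2 * _)) expr2.
have -> : 2 * (n%:R * n%:R) * `|x - y| = n%:R * (2 * (n%:R * `|x - y|)) by ring.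
rewrite ler_wpM2r ?mulr_ge0 ?ler0n// ler_nat.
by rewrite -[X in (_ <= X)%N]card_ord max_card.
Qed.

(** The Lipschitz constant [2 n ^ 2] times the spacing [2 pi / (16 n ^ 2)] is [pi / 4], hence at
    most 1. *)
Lemma subsum_grid (R : realType) (n : nat) (a phi : 'I_n -> R) (A : {set 'I_n})
    (M : R) : (0 < n)%N -> (forall k, `|a k| <= 2) ->
  (forall j : 'I_(16 * n ^ 2),
     `|subsum a phi A (j%:R * (2 * pi / (16 * n ^ 2)%:R))| <= M) ->
  forall x, `|subsum a phi A x| <= M + 1.
Proof.
move=> n0 ha hM x; set P := (16 * n ^ 2)%N in hM *.
have P0 : (0 < P)%N by rewrite muln_gt0 expn_gt0 n0.
have P0' : 0 < P%:R :> R by rewrite ltr0n.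
pose s : R := 2 * pi / P%:R.
have s0 : 0 < s by rewrite divr_gt0// mulr_gt0// pi_gt0.
pose z := Num.floor (x / s); pose j := `|(z %% P)%Z|%N.
have jE : j%:Z = (z %% P)%Z by rewrite /j gez0_abs// modz_ge0// -lt0n.
have jP : (j < P)%N by rewrite -ltz_nat jE ltz_pmod.
have zE : z%:~R = (z %/ P)%Z%:~R * P%:R + j%:R :> R.
  by rewrite [in LHS](divz_eq z P) intrD intrM -jE -!pmulrn.
have xE : subsum a phi A (z%:~R * s) = subsum a phi A (j%:R * s).
  rewrite -[RHS](subsum_periodic _ _ _ _ (z %/ P)%Z) zE; congr subsum.
  by rewrite /s; field; rewrite gt_eqF.
have near : `|x - z%:~R * s| <= s.
  have h1 : z%:~R * s <= x by rewrite -ler_pdivlMr// floor_le.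
  have h2 : x <= z%:~R * s + s.
    rewrite -[X in _ <= _ + X]mul1r -mulrDl -ler_pdivrMr// ltW//.
    by rewrite -(intrD _ z 1) floorD1_gt.
  by rewrite ger0_norm; lra.
have diff := subsum_lipschitz phi A x (z%:~R * s) ha.
have : 2 * n%:R ^+ 2 * `|x - z%:~R * s| <= 1.
  apply: (@le_trans _ _ (2 * n%:R ^+ 2 * s)); first by rewrite ler_wpM2l// mulr_ge0// sqr_ge0.
  rewrite /s mulrA ler_pdivrMr// mul1r /P natrM natrX.
  have n2 : 0 <= n%:R ^+ 2 :> R by rewrite sqr_ge0.
  have := @pihalf_lt2 R; rewrite ltr_pdivrMr// => /ltW pi4.
  have := ler_wpM2l n2 pi4; lra.
have := hM (Ordinal jP); rewrite /= -/s -xE => h1 h2.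
have := ler_normD (subsum a phi A x - subsum a phi A (z%:~R * s)) (subsum a phi A (z%:~R * s)).
by rewrite subrK; lra.
Qed.

(** * Drawing the last indices and assembling the set *)

Lemma random_fill (R : realType) (n L m : nat) (a b phi : 'I_n -> R)
    (H : {set 'I_n}) : (0 < n)%N -> (2 <= L)%N ->
  (32 * n ^ 2)%:R <= expR L%:R :> R ->
  (forall x, `|subsum a phi [set: 'I_n] x| <= 1) ->
  (forall x, `|subsum b phi [set: 'I_n] x| <= 1) ->
  filter_bound phi H 1 -> (m * L + 4 * L ^ 2 <= #|H|)%N ->
  exists T : {set 'I_n}, [/\ T \subset H, #|T| = m,
    forall x, `|subsum a phi T x| <= 22 & forall x, `|subsum b phi T x| <= 22].
Proof.
move=> n0 L2 nL ha hb hH mH.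
have L2' : 2 <= L%:R :> R by rewrite ler_nat.
have L0 : 0 < L%:R :> R by lra.
have a2 := sum_coef_sqr_le ha; have b2 := sum_coef_sqr_le hb.
rewrite expr1n mulr1 in a2; rewrite expr1n mulr1 in b2.
pose e k := a k ^+ 2 + b k ^+ 2.
have e0 k : 0 <= e k by rewrite addr_ge0 ?sqr_ge0.
have sum_e : \sum_k e k <= 4 by rewrite big_split /=; lra.
have sum_e_in (A : {set 'I_n}) : \sum_(k in A) e k <= 4.
  apply: le_trans sum_e; rewrite [leRHS](bigID (mem A)) /= lerDl.
  by rewrite sumr_ge0.
(* The large coefficients. As [e] sums to at most 4, there are at most [4 L ^ 2] of them, and
   outside [D] the terms satisfy [L * |v k y| <= 1]. *)
pose D := [set k in H | 1 < L%:R ^+ 2 * e k].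
have DH : D \subset H by apply/fintype.subsetP => k; rewrite inE => /andP[].
have cD : (#|D| <= 4 * L ^ 2)%N.
  rewrite -(ler_nat R) natrM natrX mulrC.
  apply: (@le_trans _ _ (L%:R ^+ 2 * \sum_(k in D) e k)).
    rewrite mulr_sumr -sumr_const; apply: ler_sum => k.
    by rewrite inE => /andP[_ /ltW].
  by rewrite ler_wpM2l ?sqr_ge0.
pose coef (s : bool) := if s then a else b.
have coef_e s k : coef s k ^+ 2 <= e k.
  by case: s; rewrite /e /coef ?lerDl ?lerDr sqr_ge0.
have hcoef s x : `|subsum (coef s) phi [set: 'I_n] x| <= 1 by case: s.
have coef_sqr s : \sum_k coef s k ^+ 2 <= 2 by case: s.
pose P := (16 * n ^ 2)%N.
pose v (k : 'I_n) (y : 'I_P * bool) : R :=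
  coef y.2 k * cos (k.+1%:R * (y.1%:R * (2 * pi / P%:R)) + phi k).
have v_le k y : `|v k y| <= `|coef y.2 k|.
  by rewrite normrM ler_piMr// cos_max.
have v_sqr k y : v k y ^+ 2 <= coef y.2 k ^+ 2.
  by rewrite -[leLHS]real_normK ?num_real// -[leRHS]real_normK ?num_real// lerXn2r ?nnegrE.
(* The points of [Y] are grid points paired with a choice of [a] or [b], hence [32 n ^ 2] of them.
   The sum over [H] is at most 1 and that over [D] at most [4 L], whence [c = 5] and the bound
   [2 * 5 + 11 = 21]. *)
have [||||||T [TH cT hT]] := @sampling R ('I_P * bool)%type 'I_n v L (H :\: D) 5 L2 _ _ _ _ _ m.
- by rewrite card_prod card_ord card_bool mulnAC.
- by [].
- move=> k y; rewrite inE => /andP[kD kH].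
  have : L%:R ^+ 2 * e k <= 1 by move: kD; rewrite inE kH /= -leNgt.
  have := v_sqr k y; have := coef_e y.2 k => h1 h2 h3.
  rewrite -(@expr_le1 _ 2)// ?mulr_ge0 ?ler0n// exprMn real_normK ?num_real//.
  by apply: le_trans h3; rewrite ler_wpM2l ?sqr_ge0// (le_trans h2).
- move=> y; apply: (@le_trans _ _ (\sum_k coef y.2 k ^+ 2)); last exact: coef_sqr.
  rewrite [leRHS](bigID (mem (H :\: D))) /= -[leLHS]addr0 lerD//.
    by apply: ler_sum.
  by rewrite sumr_ge0// => k _; rewrite sqr_ge0.
- move=> y.
  have -> : \sum_(k in H :\: D) v k y = \sum_(k in H) v k y - \sum_(k in D) v k y.
    by rewrite [X in _ = X - _](big_setID D) /= (finset.setIidPr DH) addrAC subrr add0r.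
  apply: (le_trans (ler_normB _ _)).
  have h1 : `|\sum_(k in H) v k y| <= 1 by exact: (hH _ (hcoef y.2)).
  (* On [D] the square of the coefficient is at most [e k], which is at most [(L * e k) ^ 2]. *)
  have h2 : `|\sum_(k in D) v k y| <= 4 * L%:R.
    apply: (le_trans (ler_norm_sum _ _ _)).
    apply: (@le_trans _ _ (\sum_(k in D) L%:R * e k)).
      apply: ler_sum => k; rewrite inE => /andP[_ kD].
      apply: (le_trans (v_le k y)).
      rewrite -ler_sqr ?nnegrE ?mulr_ge0 ?ler0n// real_normK ?num_real//.
      apply: (le_trans (coef_e y.2 k)).
      have -> : (L%:R * e k) ^+ 2 = L%:R ^+ 2 * e k * e k by ring.
      by rewrite ler_peMl// ltW.
    by rewrite -mulr_sumr mulrC ler_wpM2r ?ler0n.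
  by lra.
- by rewrite cardsD (finset.setIidPr DH); lia.
have coef2 s k : `|coef s k| <= 2.
  rewrite -ler_sqr ?nnegrE// real_normK ?num_real//.
  apply: (@le_trans _ _ 2); last by lra.
  apply: le_trans (coef_sqr s).
  by rewrite (bigD1 k)//= lerDl sumr_ge0// => i _; rewrite sqr_ge0.
have grid s x : `|subsum (coef s) phi T x| <= 22.
  have -> : 22 = 21 + 1 :> R by lra.
  apply: subsum_grid => // j.
  by have := hT (j, s); lra.
exists T; split => //; [|exact: (grid true)|exact: (grid false)].
exact: (fintype.subset_trans TH (finset.subsetDl _ _)).
Qed.

Lemma subsum_setC (R : realType) (n : nat) (a phi : 'I_n -> R) (A : {set 'I_n}) x :
  subsum a phi (~: A) x = subsum a phi [set: 'I_n] x - subsum a phi A x.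
Proof.
rewrite -(finset.setUCr A) subsumU; first by rewrite addrC addKr.
by rewrite -finset.setI_eq0 finset.setICr.
Qed.

Lemma subset_half (R : realType) (n L J m : nat) (a b phi : 'I_n -> R) :
  (427 <= n)%N -> (2 <= L)%N -> (32 * n ^ 2)%:R <= expR L%:R :> R ->
  (L <= 2 ^ (2 ^ J))%N -> (2 ^ J * (5 * 2 ^ (2 ^ J)) ^ 2 <= n)%N ->
  (2 * m <= n)%N ->
  (forall x, `|subsum a phi [set: 'I_n] x| <= 1) ->
  (forall x, `|subsum b phi [set: 'I_n] x| <= 1) ->
  exists K : {set 'I_n}, [/\ #|K| = m,
    forall x, `|subsum a phi K x| <= 150 + J%:R &
    forall x, `|subsum b phi K x| <= 150 + J%:R].
Proof.
move=> n427 L2 nL LJ Jn mn ha hb.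
have [A [AJ Ab Am hA]] := egyptian_fill phi n427 mn Jn.
pose H := multiples n (2 ^ J.+1).
have q0 : (0 < 2 ^ J.+1)%N by rewrite expn_gt0.
have [|||T [TH cT aT bT]] := @random_fill R n L (m - #|A|) a b phi H _ L2 nL ha hb.
- by lia.
- exact: filter_bound_multiples.
- rewrite card_multiples// leq_divRL//.
  have LJ1 : (5 * L <= 5 * 2 ^ (2 ^ J.+1))%N.
    by rewrite leq_mul2l; apply: (leq_trans LJ); rewrite leq_exp2l// leq_exp2l.
  have h1 : ((m - #|A|) * 2 ^ J.+2 * (5 * L) <= n)%N.
    by apply: leq_trans hA; rewrite leq_mul2l LJ1 orbT.
  have h2 : (2 ^ J * (5 * L) ^ 2 <= n)%N.
    by apply: leq_trans Jn; rewrite leq_mul2l leq_exp2r// leq_mul2l LJ !orbT.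
  move: h1 h2; rewrite !expnS expn0 muln1.
  move: (m - #|A|)%N (2 ^ J)%N => r c h1 h2.
  have e1 : (r * (2 * (2 * c)) * (5 * L) = 10 * ((r * L) * (2 * c)))%N by lia.
  have e2 : (c * (5 * L * (5 * L)) = 25 * (c * (L * L)))%N by lia.
  by rewrite mulnDl; rewrite e1 in h1; rewrite e2 in h2; lia.
have dAT : [disjoint A & T].
  apply/pred0P => k /=; apply/negP => /andP[/AJ/negP kA /(fintype.subsetP TH)].
  by rewrite inE.
exists (A :|: T); split.
- by rewrite cardsU (disjoint_setI0 dAT) cards0 subn0 cT; lia.
- move=> x; rewrite subsumU//; apply: (le_trans (ler_normD _ _)).
  by have := Ab a ha x; have := aT x; lra.
- move=> x; rewrite subsumU//; apply: (le_trans (ler_normD _ _)).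
  by have := Ab b hb x; have := bT x; lra.
Qed.

(** For [m > n / 2] the complement of a set of size [n - m] is taken; the full sum adds 1 to the
    bound. *)
Lemma subset_any (R : realType) (n L J m : nat) (a b phi : 'I_n -> R) :
  (427 <= n)%N -> (2 <= L)%N -> (32 * n ^ 2)%:R <= expR L%:R :> R ->
  (L <= 2 ^ (2 ^ J))%N -> (2 ^ J * (5 * 2 ^ (2 ^ J)) ^ 2 <= n)%N ->
  (m <= n)%N ->
  (forall x, `|subsum a phi [set: 'I_n] x| <= 1) ->
  (forall x, `|subsum b phi [set: 'I_n] x| <= 1) ->
  exists K : {set 'I_n}, [/\ #|K| = m,
    forall x, `|subsum a phi K x| <= 151 + J%:R &
    forall x, `|subsum b phi K x| <= 151 + J%:R].
Proof.
move=> n427 L2 nL LJ Jn mn ha hb.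
have [m2|m2] := leqP (2 * m) n.
  have [K [cK aK bK]] := subset_half n427 L2 nL LJ Jn m2 ha hb.
  by exists K; split=> // x; [have := aK x | have := bK x]; lra.
have [|K [cK aK bK]] := @subset_half R n L J (n - m) a b phi n427 L2 nL LJ Jn _ ha hb.
  by lia.
exists (~: K); split; first by rewrite cardsCs finset.setCK cK card_ord; lia.
- move=> x; rewrite subsum_setC; apply: (le_trans (ler_normB _ _)).
  by have := ha x; have := aK x; lra.
- move=> x; rewrite subsum_setC; apply: (le_trans (ler_normB _ _)).
  by have := hb x; have := bK x; lra.
Qed.

(** * Numerical bounds and the iterated logarithm *)

(** Induction on the degree: of the two factors [2 ^ h] with [h] half of [u], one absorbs a factor
    [h] and the other the remaining power. *)
Lemma exists_exp_dominates (C k : nat) :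
  exists u0, forall u, (u0 <= u)%N -> (C * u ^ k <= 2 ^ u)%N.
Proof.
elim: k C => [|k IH] C.
  by exists C => u Cu; rewrite expn0 muln1 (leq_trans Cu)// ltnW// ltn_expl.
have [h0 hh] := IH (C * 3 ^ k.+1)%N; exists (h0.*2 + 2)%N => u hu.
pose h := u./2.
have hh0 : (h0 <= h)%N by rewrite /h; lia.
have h1 : (0 < h)%N by rewrite /h; lia.
have uh : (u <= 3 * h)%N by rewrite /h; lia.
have hE : (h + h <= u)%N by rewrite /h; lia.
apply: (@leq_trans (2 ^ (h + h))%N); last by rewrite leq_exp2l.
rewrite expnD; apply: (@leq_trans (C * (3 * h) ^ k.+1)%N).
  by rewrite leq_mul2l leq_exp2r// uh orbT.
rewrite expnMn (expnS h) mulnA [(_ * (h * _))%N]mulnCA.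
by apply: leq_mul; [rewrite ltnW// ltn_expl | exact: hh].
Qed.

(* Needed because ln (ln (ln 21)) > 0 amounts to e^e < 21.  The bound follows
   from (1 - 1/64)^64 <= e^-1 by repeated squaring with rounding. *)
Lemma expR1_le (R : realType) : expR 1 <= 11 / 4 :> R.
Proof.
have h : (63 / 64) ^+ 64 <= expR (- 1) :> R.
  have -> : - 1 = 64%:R * (- (1 / 64)) :> R by field.
  have e64 : 63 / 64 <= expR (- (1 / 64)) :> R.
    by apply: le_trans (expR_ge1Dx _); lra.
  rewrite expRM_natl; apply: lerXn2r; rewrite ?nnegrE ?expR_ge0//.
have sq (x y z : R) k : 0 <= x -> 0 <= y -> x <= z ^+ k -> y <= x ^+ 2 -> y <= z ^+ (k * 2).
  move=> x0 y0 xz yx; rewrite exprM; apply: (le_trans yx).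
  by rewrite lerXn2r ?nnegrE// (le_trans x0).
have h2 : 125 / 129 <= (63 / 64) ^+ 2 :> R by lra.
have h4 : 123 / 131 <= (63 / 64) ^+ 4 :> R by apply: (sq _ _ _ 2 _ _ h2); lra.
have h8 : 67 / 76 <= (63 / 64) ^+ 8 :> R by apply: (sq _ _ _ 4 _ _ h4); lra.
have h16 : 129 / 166 <= (63 / 64) ^+ 16 :> R by apply: (sq _ _ _ 8 _ _ h8); lra.
have h32 : 32 / 53 <= (63 / 64) ^+ 32 :> R by apply: (sq _ _ _ 16 _ _ h16); lra.
have h64 : 4 / 11 <= expR (- 1) :> R.
  apply: le_trans h; apply: (@sq _ _ _ 32%N _ _ h32); lra.
have := expRxMexpNx_1 (1 : R); have := expR_gt0 (1 : R).
nra.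
Qed.

Lemma ln21_gt3 (R : realType) : 3 < ln 21 :> R.
Proof.
rewrite -ltr_expR lnK ?posrE; last by lra.
have -> : 3 = 3%:R * 1 :> R by rewrite mulr1.
rewrite expRM_natl.
apply: (@le_lt_trans _ _ ((11 / 4) ^+ 3)); last by lra.
by rewrite lerXn2r ?nnegrE ?expR_ge0 ?expR1_le//; lra.
Qed.

Lemma ln3_gt1 (R : realType) : 1 < ln 3 :> R.
Proof.
rewrite -ltr_expR lnK ?posrE; last by lra.
by have := expR1_le R; lra.
Qed.

Lemma ln2_ge (R : realType) : 1 / 2 <= ln 2 :> R.
Proof.
rewrite -ler_expR lnK ?posrE; last by lra.
have := expRxMexpNx_1 (1 / 2 : R); have := expR_gt0 (1 / 2 : R).
have := expR_ge1Dx (- (1 / 2) : R); nra.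
Qed.

Lemma ln_ln_ln_gt0 (R : realType) : 0 < ln (ln (ln 21)) :> R.
Proof.
have h1 := ln21_gt3 R; have h2 := ln3_gt1 R.
have h3 : ln 3 < ln (ln 21) :> R by rewrite ltr_ln ?posrE//; lra.
by apply: ln_gt0; lra.
Qed.

Lemma le_ln_ln_ln (R : realType) (n : nat) : (0 < n)%N ->
  ln (ln (ln 21)) <= ln (ln (ln (n + 20)%:R)) :> R.
Proof.
move=> n0; have h1 := ln21_gt3 R; have h2 := ln3_gt1 R.
have h3 : ln 21 <= ln (n + 20)%:R :> R.
  by rewrite ler_ln ?posrE ?ltr0n ?ler_nat//; lia.
have h4 : ln 3 < ln (ln 21) :> R by rewrite ltr_ln ?posrE//; lra.
have h5 : ln (ln 21) <= ln (ln (n + 20)%:R) :> R by rewrite ler_ln ?posrE//; lra.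
by rewrite ler_ln ?posrE//; lra.
Qed.

(** Three logarithms are taken in turn; each costs a factor 2 because [ln 2 >= 1 / 2]. The 12 is
    twice the crude bound [ln 6 < 6]. *)
Lemma double_exp_bound (R : realType) (n u J : nat) : (0 < n)%N ->
  (2 ^ u.-1 <= n)%N -> (2 ^ (2 ^ J) <= 2 * u + 5)%N ->
  J%:R <= 12 + 2 * ln (ln (ln (n + 20)%:R)) :> R.
Proof.
move=> n0 un Ju; set t := ln (n + 20)%:R.
have l2 := ln2_ge R.
have t3 : 3 <= t.
  apply: (le_trans (ltW (ln21_gt3 R))).
  by rewrite ler_ln ?posrE ?ltr0n ?ler_nat//; lia.
have ln2X k : ln (2 ^ k)%:R = k%:R * ln 2 :> R.
  by rewrite natrX lnXn// mulr_natl.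
have step (k : nat) (y : R) : (2 ^ k)%:R <= y -> k%:R * ln 2 <= ln y.
  move=> ky; have k0 : 0 < (2 ^ k)%:R :> R by rewrite ltr0n expn_gt0.
  by rewrite -ln2X ler_ln ?posrE// (lt_le_trans k0).
have half (k : nat) (y : R) : k%:R * ln 2 <= y -> k%:R <= 2 * y.
  by move=> ky; have := ler_wpM2l (ler0n R k) l2; lra.
have h1 : u.-1%:R <= 2 * t by apply/half/step; rewrite ler_nat; lia.
have h2 : (2 ^ (2 ^ J))%:R <= t ^+ 3.
  (* A cube absorbs the constants, since [t >= 3], and becomes a mere factor 3 under the next
     logarithm. *)
  apply: (@le_trans _ _ (4 * t + 7)); last by nra.
  apply: (@le_trans _ _ (2 * u.-1%:R + 7)); last by lra.
  by rewrite -natrM -natrD ler_nat; lia.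
have h3 : (2 ^ J)%:R <= 2 * (3 * ln t).
  by apply: half; rewrite (_ : 3 * ln t = ln (t ^+ 3)) ?step// lnXn ?mulr_natl//; lra.
have lnt0 : 0 < ln t by apply: ln_gt0; lra.
have h4 : J%:R <= 2 * ln (6 * ln t).
  by apply: half; apply: step; lra.
have ln6 : ln 6 < 6 :> R by apply: ln_sublinear; lra.
rewrite lnM ?posrE// in h4; lra.
Qed.

(** * Choice of the parameters and the case of real coefficients *)

Lemma large_degree (R : realType) : exists N0 : nat,
  forall (n m : nat) (a b phi : 'I_n -> R), (N0 <= n)%N -> (m <= n)%N ->
  (forall x, `|subsum a phi [set: 'I_n] x| <= 1) ->
  (forall x, `|subsum b phi [set: 'I_n] x| <= 1) ->
  exists K : {set 'I_n}, [/\ #|K| = m,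
    forall x, `|subsum a phi K x| <= 164 + 2 * ln (ln (ln (n + 20)%:R)) &
    forall x, `|subsum b phi K x| <= 164 + 2 * ln (ln (ln (n + 20)%:R))].
Proof.
have [u0 hu0] := exists_exp_dominates (50 * 7 ^ 6) 6.
exists (2 ^ u0 + 427)%N => n m a b phi hn mn ha hb.
(* This [L] gives [32 n ^ 2 <= 2 ^ L <= expR L]. *)
pose u := up_log 2 n; pose L := (2 * u + 5)%N.
have n1 : (1 < n)%N by lia.
have nu : (n <= 2 ^ u)%N by exact: up_logP.
have un : (2 ^ u.-1 < n)%N by exact: up_log_gtn.
have u0u : (u0 <= u)%N by rewrite -(@leq_exp2l 2)//; lia.
have u_pos : (0 < u)%N.
  by rewrite lt0n; apply: contraTneq nu => ->; rewrite -ltnNge.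
have nL : (32 * n ^ 2)%:R <= expR L%:R :> R.
  apply: (@le_trans _ _ (2 ^ L)%:R).
    rewrite ler_nat /L addnC expnD leq_mul2l /=.
    by rewrite mulnC expnM leq_exp2r.
  rewrite -[L%:R]mulr1 expRM_natl natrX.
  by rewrite lerXn2r ?nnegrE ?expR_ge0//; have := expR_ge1Dx (1 : R); lra.
have exJ : exists J, (L <= 2 ^ (2 ^ J))%N.
  by exists L; rewrite ltnW// (ltn_trans (ltn_expl L (ltnSn 1)))// ltn_expl.
case: (ex_minnP exJ) => J LJ Jmin.
have J0 : (0 < J)%N by rewrite lt0n; apply: contraTneq LJ => ->; rewrite /L; lia.
have J1 : (2 ^ (2 ^ J.-1) < L)%N.
  by rewrite ltnNge; apply/negP => /Jmin; lia.
(* Minimality of [J] keeps the double exponential below [L ^ 2], so the condition on [n] reduces to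
   [25 L ^ 6 <= n], polynomial in [log n]. *)
have VL : (2 ^ (2 ^ J) <= L ^ 2)%N.
  rewrite -(prednK J0) expnSr expnM leq_exp2r//; exact: ltnW.
have JV : (2 ^ J <= 2 ^ (2 ^ J))%N by rewrite leq_exp2l// ltnW// ltn_expl.
have Jn : (2 ^ J * (5 * 2 ^ (2 ^ J)) ^ 2 <= n)%N.
  apply: leq_trans (ltnW un).
  have L7 : (L <= 7 * u)%N by rewrite /L; lia.
  have := hu0 u u0u; rewrite -{2}(prednK u_pos) (expnS 2) => h.
  rewrite -(@leq_pmul2l 2)//; apply: leq_trans h.
  apply: (@leq_trans (50 * L ^ 6)%N).
    rewrite (_ : L ^ 6 = L ^ 2 * (L ^ 2) ^ 2)%N; last by rewrite -expnM -expnD.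
    rewrite (_ : 2 * _ = 50 * (2 ^ J * (2 ^ (2 ^ J)) ^ 2))%N.
      by rewrite leq_mul2l /= leq_mul ?leq_exp2r// (leq_trans JV).
    by rewrite expnMn; lia.
  by rewrite -mulnA -expnMn leq_mul2l /= leq_exp2r.
have n427 : (427 <= n)%N by rewrite (leq_trans _ hn)// leq_addl.
have [|K [cK aK bK]] := @subset_any R n L J m a b phi n427 _ nL LJ Jn mn ha hb.
  by rewrite /L; lia.
have JB : J.-1%:R <= 12 + 2 * ln (ln (ln (n + 20)%:R)) :> R.
  by apply: double_exp_bound (ltnW un) (ltnW J1); lia.
have JE : J%:R = J.-1%:R + 1 :> R by rewrite natr1 prednK.
by exists K; split=> // x; [apply: le_trans (aK x) _ | apply: le_trans (bK x) _]; lra.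
Qed.

(** Below [N0] any set of size [m] works: the coefficients are at most 2, and the resulting [2 * N0]
    is absorbed because the triple logarithm is at least its positive value [c] at [n = 1]. *)
Lemma real_subset (R : realType) : exists C : R, 0 < C /\
  forall (n m : nat) (a b phi : 'I_n -> R), (0 < n)%N -> (m <= n)%N ->
  (forall x, `|subsum a phi [set: 'I_n] x| <= 1) ->
  (forall x, `|subsum b phi [set: 'I_n] x| <= 1) ->
  exists K : {set 'I_n}, [/\ #|K| = m,
    forall x, `|subsum a phi K x| <= C * ln (ln (ln (n + 20)%:R)) &
    forall x, `|subsum b phi K x| <= C * ln (ln (ln (n + 20)%:R))].
Proof.
have [N0 large] := large_degree R.
have c0 := ln_ln_ln_gt0 R; set c := ln _ in c0.
have N00 : 0 <= N0%:R :> R by [].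
exists ((164 + 2 * N0%:R) / c + 2); split.
  by rewrite addr_gt0// divr_gt0//; lra.
move=> n m a b phi n0 mn ha hb.
have cn : c <= ln (ln (ln (n + 20)%:R)) := le_ln_ln_ln R n0.
move: cn (large n m a b phi); set l := ln (ln (ln (n + 20)%:R)) => cn {}large.
have bound (y : R) : y <= 164 + 2 * N0%:R + 2 * l -> y <= ((164 + 2 * N0%:R) / c + 2) * l.
  move=> hy; apply: (le_trans hy); rewrite [leRHS]mulrDl lerD2r.
  by rewrite mulrAC ler_pdivlMr// ler_wpM2l//; lra.
have [nN|nN] := leqP N0 n.
  have [K [cK aK bK]] := large nN mn ha hb.
  by exists K; split=> // x; apply: bound; [have := aK x | have := bK x]; lra.
have [|K _ cK] := @subset_of_card _ [set: 'I_n] m; first by rewrite cardsT card_ord.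
have small (e : 'I_n -> R) : (forall x, `|subsum e phi [set: 'I_n] x| <= 1) ->
    forall x, `|subsum e phi K x| <= 2 * N0%:R.
  move=> he x; apply: (le_trans (ler_norm_sum _ _ _)).
  apply: (@le_trans _ _ (\sum_(k in K) 2)).
    apply: ler_sum => k _; rewrite normrM.
    apply: (@le_trans _ _ `|e k|); first by rewrite ler_piMr// cos_max.
    rewrite -ler_sqr ?nnegrE// real_normK ?num_real//.
    apply: (@le_trans _ _ (2 * 1 ^+ 2)); last by lra.
    apply: le_trans (sum_coef_sqr_le he).
    by rewrite (bigD1 k)//= lerDl sumr_ge0// => i _; rewrite sqr_ge0.
  rewrite sumr_const -[_ *+ _]mulr_natr ler_wpM2l// ler_nat.
  by rewrite cK (leq_trans mn)// ltnW.
by exists K; split=> // x; apply: bound; [have := small a ha x | have := small b hb x]; lra.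
Qed.

(** * Scaling and complex coefficients *)

Lemma subsumZ (R : realType) (n : nat) (a phi : 'I_n -> R) (A : {set 'I_n}) (c x : R) :
  subsum (fun k => c * a k) phi A x = c * subsum a phi A x.
Proof. by rewrite mulr_sumr; apply: eq_bigr => k _; rewrite mulrA. Qed.

Lemma normalized_coef (R : realType) (n : nat) (a phi : 'I_n -> R) (B : R) :
  (forall x, `|subsum a phi [set: 'I_n] x| <= B) ->
  (forall x, `|subsum (fun k => B^-1 * a k) phi [set: 'I_n] x| <= 1) /\
  forall A x, subsum a phi A x = B * subsum (fun k => B^-1 * a k) phi A x.
Proof.
move=> ha; have B0 : 0 <= B by apply: le_trans (ha 0).
have [BE|Bn0] := eqVneq B 0; last first.
  have B_gt0 : 0 < B by rewrite lt_def Bn0.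
  split=> [x|A x]; rewrite subsumZ; last by rewrite mulVKf.
  by rewrite normrM gtr0_norm ?invr_gt0// ler_pdivrMl// mulr1.
(* When [B = 0] the inverse is [0] by convention, so the second claim requires that all coefficients
   vanish, which the mean square bound gives. *)
have az k : a k = 0.
  apply/eqP; rewrite -sqrf_eq0 eq_le sqr_ge0 andbT.
  have := sum_coef_sqr_le ha; rewrite BE expr0n mulr0; apply: le_trans.
  by rewrite (bigD1 k)//= lerDl sumr_ge0// => i _; rewrite sqr_ge0.
split=> [x|A x]; first by rewrite subsumZ BE invr0 mul0r normr0.
by rewrite BE mul0r /subsum big1// => k _; rewrite az mul0r.
Qed.

Lemma normr_Re_le (R : realType) (z : R[i]) : `|complex.Re z| <= Normc.normc z.
Proof. by case: z => x y /=; rewrite -sqrtr_sqr ler_wsqrtr// lerDl sqr_ge0. Qed.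

Lemma normr_Im_le (R : realType) (z : R[i]) : `|complex.Im z| <= Normc.normc z.
Proof. by case: z => x y /=; rewrite -sqrtr_sqr ler_wsqrtr// lerDr sqr_ge0. Qed.

Lemma normc_le (R : realType) (z : R[i]) : Normc.normc z <= `|complex.Re z| + `|complex.Im z|.
Proof.
case: z => x y /=; have xy0 : 0 <= `|x| + `|y| by rewrite addr_ge0.
rewrite -(ger0_norm xy0) -sqrtr_sqr ler_wsqrtr// sqrrD !real_normK ?num_real//.
by rewrite lerD2r lerDl mulrn_wge0// mulr_ge0.
Qed.

Lemma Re_cosine_sum (R : realType) (n : nat) (d : 'I_n -> R[i]) (phi : 'I_n -> R)
    (A : {set 'I_n}) (x : R) :
  complex.Re (\sum_(k in A) cosine_term d phi k x) = subsum (fun k => complex.Re (d k)) phi A x.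
Proof.
rewrite (big_morph _ (_ : {morph @complex.Re R : u v / u + v}) (erefl : complex.Re 0 = 0)).
  by apply: eq_bigr => k _; rewrite /cosine_term; case: (d k) => u v /=; rewrite mulr0 subr0.
by move=> [? ?] [].
Qed.

Lemma Im_cosine_sum (R : realType) (n : nat) (d : 'I_n -> R[i]) (phi : 'I_n -> R)
    (A : {set 'I_n}) (x : R) :
  complex.Im (\sum_(k in A) cosine_term d phi k x) = subsum (fun k => complex.Im (d k)) phi A x.
Proof.
rewrite (big_morph _ (_ : {morph @complex.Im R : u v / u + v}) (erefl : complex.Im 0 = 0)).
  by apply: eq_bigr => k _; rewrite /cosine_term; case: (d k) => u v /=; rewrite mulr0 add0r.
by move=> [? ?] [].
Qed.

Lemma unorm_le (R : realType) (g : R -> R[i]) (M : R) :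
  (forall x, Normc.normc (g x) <= M) -> unorm g <= M.
Proof.
move=> hM; apply: ge_sup; first by exists (Normc.normc (g 0)), 0.
by move=> _ [x _ <-].
Qed.

(** A bound [M] is enough to rule out the junk value of [sup]. *)
Lemma unorm_ub (R : realType) (g : R -> R[i]) (M : R) :
  (forall x, Normc.normc (g x) <= M) -> forall x, Normc.normc (g x) <= unorm g.
Proof.
move=> hM x; apply: ub_le_sup; last by exists x.
by exists M => _ [y _ <-].
Qed.

Lemma subsum_bounded (R : realType) (n : nat) (a phi : 'I_n -> R) (A : {set 'I_n}) x :
  `|subsum a phi A x| <= \sum_k `|a k|.
Proof.
apply: (le_trans (ler_norm_sum _ _ _)).
apply: (@le_trans _ _ (\sum_(k in A) `|a k|)).
  by apply: ler_sum => k _; rewrite normrM ler_piMr// cos_max.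
by rewrite [leRHS](bigID (mem A)) /= lerDl sumr_ge0.
Qed.

Theorem theorem3 (R : realType) :
  exists C : R, 0 < C /\
    forall (n : nat) (d : 'I_n -> R[i]) (phi : 'I_n -> R), (0 < n)%N ->
    forall m : nat, (0 < m <= n)%N ->
    exists K : {set 'I_n}, #|K| = m /\
      unorm (fun x : R => \sum_(k in K) cosine_term d phi k x) <=
      C * ln (ln (ln (n + 20)%:R)) *
        unorm (fun x : R => \sum_(k < n) cosine_term d phi k x).
Proof.
have [C [C0 hC]] := real_subset R.
(* The factor 2 accounts for the real and imaginary parts, both selected by the same [K]. *)
exists (2 * C); split => [|n d phi n0 m /andP[_ mn]]; first by rewrite mulr_gt0.
set S := fun x : R => \sum_(k < n) cosine_term d phi k x; set B := unorm S.
have SE x : S x = \sum_(k in [set: 'I_n]) cosine_term d phi k x.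
  by apply: eq_bigl => k; rewrite inE.
have SB x : Normc.normc (S x) <= B.
  apply: (@unorm_ub _ _ (\sum_k `|complex.Re (d k)| + \sum_k `|complex.Im (d k)|)) => y.
  by apply: (le_trans (normc_le _)); rewrite SE Re_cosine_sum Im_cosine_sum lerD ?subsum_bounded.
have [|a1 aE] := @normalized_coef R n (fun k => complex.Re (d k)) phi B.
  by move=> x; rewrite -Re_cosine_sum -SE; apply: le_trans (normr_Re_le _) (SB x).
have [|b1 bE] := @normalized_coef R n (fun k => complex.Im (d k)) phi B.
  by move=> x; rewrite -Im_cosine_sum -SE; apply: le_trans (normr_Im_le _) (SB x).
have [K [cK aK bK]] := hC n m _ _ phi n0 mn a1 b1.
exists K; split => //; apply: unorm_le => x; apply: (le_trans (normc_le _)).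
have B0 : 0 <= B by apply: le_trans (SB 0); case: (S 0) => ? ? /=; rewrite sqrtr_ge0.
rewrite Re_cosine_sum Im_cosine_sum aE bE !normrM (ger0_norm B0) -mulrDr mulrC.
by rewrite ler_wpM2r//; have := aK x; have := bK x; lra.
Qed.
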